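(* Let $T$ be a tree, let $\mu$ be a positive function on $T$, and let $\varphi$ be a self-map of $T$. If $C_\varphi$ is a surjective isometry on $L_\mu^\infty$, then $\varphi$ is bijective and $\frac{\mu(v)}{\mu(\varphi(v))} = 1$ for all $v \in T$.
   Context: A tree $T$ is a locally finite, connected, simply-connected graph, identified as a set with its set of vertices; it is assumed to have no terminal vertices (a vertex is terminal if it has a unique neighbor), hence to be infinite, and it is rooted at a vertex $o$. A function on $T$ is a complex-valued function on the set of vertices. For a positive function $\mu: T \to (0,\infty)$ (the weight), $L_\mu^\infty$ is the Banach space of all functions $f$ on $T$ with $\|f\|_\mu = \sup_{v \in T} \mu(v)|f(v)| < \infty$. For an arbitrary self-map $\varphi$ of (the vertex set of) $T$, the composition operator is $C_\varphi f = f \circ \varphi$. It is a surjective isometry on $L_\mu^\infty$ if it maps $L_\mu^\infty$ onto itself and $\|C_\varphi f\|_\mu = \|f\|_\mu$ for all $f \in L_\mu^\infty$. *)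

(* Defs.v *)
From HB Require Import structures.
From mathcomp Require Import all_boot all_order all_algebra.
From mathcomp Require Import all_classical all_reals all_analysis.
From mathcomp Require Import complex.
Set Implicit Arguments.
Unset Strict Implicit.
Unset Printing Implicit Defensive.
Import Order.TTheory GRing.Theory Num.Theory.
Local Open Scope classical_set_scope.
Local Open Scope ring_scope.

Section Graph.
Variables (T : eqType) (e : rel T).

Definition locally_finite_graph := forall x : T, finite_set [set y | e x y].

Definition connected_graph :=
  forall x y : T, exists2 p : seq T, path e x p & last x p = y.

(* A graph is simply connected when it has no cycle with at least three
   vertices; the bound is needed because [:: x; y] is a cycle of the symmetric
   relation e for each edge x -- y. *)
Definition simply_connected_graph :=
  forall c : seq T, ucycle e c -> (size c <= 2)%N.

Definition terminal_vertex (x : T) := exists! y : T, e x y.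

End Graph.

Record tree := Tree {
  vertex :> eqType;
  adj : rel vertex;
  root : vertex;
  adj_sym : symmetric adj;
  adj_irrefl : irreflexive adj;
  tree_locally_finite : locally_finite_graph adj;
  tree_connected : connected_graph adj;
  tree_simply_connected : simply_connected_graph adj;
  tree_no_terminal : forall x : vertex, ~ terminal_vertex adj x;
  (* This follows from the other fields except for the graph with one vertex,
     whose only vertex has no neighbor and hence is not terminal. *)
  tree_infinite : infinite_set [set: vertex]
}.

Section WeightedSpace.
Variables (R : realType) (T : tree) (mu : T -> R).
Local Open Scope ereal_scope.

(* Normc.normc is the modulus as an element of R, whereas `|z| lies in R[i].
   The supremum is taken in \bar R, so that it is defined for every f. *)
Definition weighted_norm (f : T -> R[i]) : \bar R :=
  ereal_sup [set (mu v * Normc.normc (f v))%:E | v in [set: T]].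

Definition Linfty_weighted : set (T -> R[i]) :=
  [set f | weighted_norm f < +oo].

Definition surjective_isometry (A : (T -> R[i]) -> (T -> R[i])) :=
  A @` Linfty_weighted = Linfty_weighted /\
  forall f, Linfty_weighted f -> weighted_norm (A f) = weighted_norm f.

End WeightedSpace.

Definition composition_operator (R : realType) (T : tree) (phi : T -> T)
  (f : T -> R[i]) : T -> R[i] := f \o phi.

(* Main.v *)
Require Import Defs.
From HB Require Import structures.
From mathcomp Require Import all_boot all_order all_algebra.
From mathcomp Require Import all_classical all_reals all_analysis.
From mathcomp Require Import complex.
Import Order.TTheory GRing.Theory Num.Theory.
Local Open Scope ring_scope.

(** Everything is tested on point masses.  The point mass at [w] has weighted
    norm [mu w], so it belongs to the space and has nonzero norm.  Composing it
    with [phi] yields the indicator function of the fibre of [phi] over [w].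

    - An empty fibre would give the zero function, of norm 0 instead of
      [mu w]; so [phi] is surjective, because the operator is isometric.
    - Every function in the range of the operator is constant on the fibres of
      [phi]; since the point mass at [a] is in that range, no other point lies
      in the fibre of [a], and [phi] is injective.
    - The fibre over [phi v] is therefore [v] alone, so the operator sends the
      point mass at [phi v] to the point mass at [v], and comparing norms gives
      [mu v = mu (phi v)]. *)

Definition point_mass (R : realType) {T : tree} (w : T) : T -> R[i] :=
  fun v => (v == w)%:R.

Lemma normc_point_mass (R : realType) (T : tree) (w v : T) :
  Normc.normc (point_mass R w v) = (v == w)%:R.
Proof.
rewrite /point_mass; case: eqP => _; first exact: Normc.normc1.
exact: Normc.normc0.
Qed.

Lemma weighted_norm_point_mass {R : realType} {T : tree} {mu : T -> R} {w : T} :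
  0 < mu w -> weighted_norm mu (point_mass R w) = (mu w)%:E.
Proof.
move=> mu_gt0; apply/eqP; rewrite eq_le; apply/andP; split.
- apply: ge_ereal_sup => _ [v _ <-]; rewrite lee_fin normc_point_mass.
  by case: eqVneq => [->|_]; rewrite ?mulr1 // mulr0 ltW.
- apply: ereal_sup_ubound => /=; exists w => //.
  by rewrite normc_point_mass eqxx mulr1.
Qed.

Lemma point_mass_Linfty {R : realType} {T : tree} {mu : T -> R} {w : T} :
  0 < mu w -> Linfty_weighted mu (point_mass R w).
Proof.
by move=> mu_gt0; rewrite /Linfty_weighted /= weighted_norm_point_mass // ltry.
Qed.

Lemma weighted_norm0 (R : realType) (T : tree) (mu : T -> R) :
  weighted_norm mu (fun=> 0) = 0%E.
Proof.
have normc0 : Normc.normc (0 : R[i]) = 0 by exact: Normc.normc0.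
rewrite /weighted_norm -[RHS]ereal_sup1; congr ereal_sup.
apply/seteqP; split=> [_ [v _ <-]|_ ->]; first by rewrite normc0 mulr0.
by exists (Defs.root T) => //; rewrite normc0 mulr0.
Qed.

(** A function of the form [g \o phi] cannot separate two points of the same
    fibre, whereas point masses separate all points. *)
Lemma onto_composition_injective (R : realType) (T : tree) (mu : T -> R)
    (phi : T -> T) :
  (forall v, 0 < mu v) ->
  (Linfty_weighted mu `<=`
     composition_operator (R := R) phi @` Linfty_weighted mu)%classic ->
  injective phi.
Proof.
move=> mu_gt0 onto a b phi_ab.
have [g _ gphi] := onto _ (point_mass_Linfty (mu_gt0 a)).
have ga : g (phi a) = point_mass R a a by rewrite -gphi.
have gb : g (phi b) = point_mass R a b by rewrite -gphi.
move: gb; rewrite -phi_ab ga /point_mass eqxx.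
by case: eqVneq => // _ /eqP; rewrite oner_eq0.
Qed.

Lemma isometric_composition_surjective {R : realType} {T : tree} {mu : T -> R}
    {phi : T -> T} :
  (forall v, 0 < mu v) ->
  (forall f : T -> R[i], Linfty_weighted mu f ->
     weighted_norm mu (composition_operator phi f) = weighted_norm mu f) ->
  forall w, exists v, phi v = w.
Proof.
move=> mu_gt0 iso w; apply: contrapT => w_notin.
have fibre0 : composition_operator phi (point_mass R w) = fun=> 0.
  apply/funext => v; rewrite /composition_operator /point_mass /=.
  by case: eqVneq => // phi_v; case: w_notin; exists v.
have := iso _ (point_mass_Linfty (mu_gt0 w)).
rewrite fibre0 weighted_norm0 weighted_norm_point_mass // => -[] mu0.
by have := mu_gt0 w; rewrite -mu0 ltxx.
Qed.

Theorem theorem5p6 (R : realType) (T : tree) (mu : T -> R) (phi : T -> T)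
    (mu_gt0 : forall v : T, 0 < mu v)
    (Cphi_iso : @surjective_isometry R T mu (@composition_operator R T phi)) :
  bijective phi /\ (forall v : T, mu v / mu (phi v) = 1).
Proof.
have [img iso] := Cphi_iso.
have phi_inj : injective phi.
  by apply: (@onto_composition_injective R T mu) => //; rewrite img.
have phi_surj := isometric_composition_surjective mu_gt0 iso.
split.
  pose psi w := projT1 (cid (phi_surj w)).
  have psiK : cancel psi phi by move=> w; exact: projT2 (cid (phi_surj w)).
  by exists psi => // v; apply: phi_inj; rewrite psiK.
move=> v.
have fibre1 : composition_operator phi (point_mass R (phi v)) = point_mass R v.
  apply/funext => u.
  by rewrite /composition_operator /point_mass /= (inj_eq phi_inj).
have := iso _ (point_mass_Linfty (mu_gt0 (phi v))).
rewrite fibre1 !weighted_norm_point_mass // => -[] ->.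
by rewrite divff // gt_eqF.
Qed.
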